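(* Let $0<\alpha<1$, let $A$ be a strictly positive continuous function, and let $U_L=(\rho_L,u_L,v_L)$, $U_R=(\rho_R,u_R,v_R)$ with $\rho_L,\rho_R>0$. Write $A_L=A(v_L)$, $A_R=A(v_R)$, $r=(A_R/A_L)^{1/\alpha}$, $\gamma=\frac{\alpha+1}{2}$, $\rho_{\min}=\min\{\rho_R,r\rho_L\}$, $\rho_{\max}=\max\{\rho_R,r\rho_L\}$. Then: (a) $U_L$ is connected to $U_R$ by a wave combination $R_1+CD+R_3$ if and only if $$u_R>u_L+\frac{2\sqrt{\alpha A_R}}{\alpha+1}\Big(\frac1{\rho_{\min}^{\gamma}}-\frac1{\rho_R^{\gamma}}\Big)+\frac{2\sqrt{\alpha A_L}}{\alpha+1}\Big(\frac1{(\rho_{\min}/r)^{\gamma}}-\frac1{\rho_L^{\gamma}}\Big).$$ (b) $U_L$ is connected to $U_R$ by $R_1+CD+S_3$ if and only if $\rho_R<r\rho_L$ and $$u_L-\sqrt{A_R\Big(\frac1{r\rho_L}-\frac1{\rho_R}\Big)\Big(\frac1{(r\rho_L)^\alpha}-\frac1{\rho_R^\alpha}\Big)}<u_R<u_L+\frac{2\sqrt{\alpha A_L}}{\alpha+1}\Big(\frac1{(\rho_R/r)^{\gamma}}-\frac1{\rho_L^{\gamma}}\Big).$$ (c) $U_L$ is connected to $U_R$ by $S_1+CD+R_3$ if and only if $r\rho_L<\rho_R$ and $$u_L-\sqrt{A_L\Big(\frac{r}{\rho_R}-\frac1{\rho_L}\Big)\Big(\frac{r^\alpha}{\rho_R^\alpha}-\frac1{\rho_L^\alpha}\Big)}<u_R<u_L+\frac{2\sqrt{\alpha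 A_R}}{\alpha+1}\Big(\frac1{(r\rho_L)^{\gamma}}-\frac1{\rho_R^{\gamma}}\Big).$$ (d) $U_L$ is connected to $U_R$ by $S_1+CD+S_3$ if and only if $$u_R>u_L-\sqrt{\frac{A_R}{\rho_R^{\alpha+1}}}-\sqrt{\frac{A_L}{\rho_L^{\alpha+1}}}$$ and $$u_R<u_L-\sqrt{A_R\Big(\frac1{\rho_{\max}}-\frac1{\rho_R}\Big)\Big(\frac1{\rho_{\max}^\alpha}-\frac1{\rho_R^\alpha}\Big)}-\sqrt{A_L\Big(\frac{r}{\rho_{\max}}-\frac1{\rho_L}\Big)\Big(\frac{r^\alpha}{\rho_{\max}^\alpha}-\frac1{\rho_L^\alpha}\Big)}.$$ In each case the intermediate states $U_{M_1},U_{M_2}$ are uniquely determined, and the four regions of right states are pairwise disjoint, so there is at most one such classical wave combination connecting $U_L$ to $U_R$. Moreover, allowing some of the waves to be trivial, the Riemann problem admits a classical solution when $u_R>u_L-\sqrt{A_R/\rho_R^{\alpha+1}}-\sqrt{A_L/\rho_L^{\alpha+1}}$, and admits no classical solution when $u_R<u_L-\sqrt{A_R/\rho_R^{\alpha+1}}-\sqrt{A_L/\rho_L^{\alpha+1}}$.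
   Context: System: $\rho_t+(\rho u)_x=0$, $(\rho u)_t+(\rho u^2-A(v)\rho^{-\alpha})_x=0$, $(\rho v)_t+(\rho uv)_x=0$, $\rho>0$, with Riemann data $U_L$ ($x<0$), $U_R$ ($x>0$). A wave combination $X_1+CD+Y_3$ with $X,Y\in\{R,S\}$ connecting $U_L$ to $U_R$ is a pair of states $U_{M_1}=(\rho_{M_1},u_{M_1},v_L)$, $U_{M_2}=(\rho_{M_2},u_{M_2},v_R)$ with positive densities, $U_{M_1}\in X_1(U_L)$, $u_{M_1}=u_{M_2}$ and $\rho_{M_1}=(A_L/A_R)^{1/\alpha}\rho_{M_2}$ (contact discontinuity), and $U_{M_2}\in IY_3(U_R)$ (the set of states that can be joined on the left to $U_R$ by a 3-wave), where: $R_1(U_L)$: $v=v_L$, $0<\rho<\rho_L$, $u=u_L+\frac{2\sqrt{\alpha A_L}}{\alpha+1}(\rho^{-\frac{\alpha+1}2}-\rho_L^{-\frac{\alpha+1}2})$. $S_1(U_L)$: $v=v_L$, $\rho>\rho_L$, $u=u_L-\sqrt{A_L(\frac1\rho-\frac1{\rho_L})(\frac1{\rho^\alpha}-\frac1{\rho_L^\alpha})}$. $IR_3(U_R)$: $v=v_R$, $0<\rho<\rho_R$, $u=u_R-\frac{2\sqrt{\alpha A_R}}{\alpha+1}(\rho^{-\frac{\alpha+1}2}-\rho_R^{-\frac{\alpha+1}2})$. $IS_3(U_R)$: $v=v_R$, $\rho>\rho_R$, $u=u_R+\sqrt{A_R(\frac1\rho-\frac1{\rho_R})(\frac1{\rho^\alpha}-\frac1{\rho_R^\alpha})}$.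 A classical solution is a solution consisting of a 1-wave (rarefaction or shock), a contact discontinuity and a 3-wave of these types; a trivial 1-wave or 3-wave means $U_{M_1}=U_L$ or $U_{M_2}=U_R$. *)

(* Defs.v *)
From Stdlib Require Import Reals.
Open Scope R_scope.

Record state : Type := mkState { rho : R; u : R; v : R }.

Inductive wave_kind : Type := Rarefaction | Shock.

(* [wave1 alpha A X UL U]: U can be joined on the right to UL by a nontrivial
   1-wave of kind X, i.e. U lies on the curve R_1(UL), resp. S_1(UL). *)
Definition wave1 (alpha : R) (A : R -> R) (X : wave_kind) (UL U : state)
  : Prop :=
  match X with
  | Rarefaction =>
      v U = v UL /\ 0 < rho U < rho UL /\
      u U = u UL + 2 * sqrt (alpha * A (v UL)) / (alpha + 1)
                   * (Rpower (rho U) (- ((alpha + 1) / 2))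
                      - Rpower (rho UL) (- ((alpha + 1) / 2)))
  | Shock =>
      v U = v UL /\ rho U > rho UL /\
      u U = u UL - sqrt (A (v UL) * (1 / rho U - 1 / rho UL)
                         * (1 / Rpower (rho U) alpha
                            - 1 / Rpower (rho UL) alpha))
  end.

(* [wave3_inv alpha A Y UR U]: U can be joined on the left to UR by a
   nontrivial 3-wave of kind Y, i.e. U lies on IR_3(UR), resp. IS_3(UR). *)
Definition wave3_inv (alpha : R) (A : R -> R) (Y : wave_kind) (UR U : state)
  : Prop :=
  match Y with
  | Rarefaction =>
      v U = v UR /\ 0 < rho U < rho UR /\
      u U = u UR - 2 * sqrt (alpha * A (v UR)) / (alpha + 1)
                   * (Rpower (rho U) (- ((alpha + 1) / 2))
                      - Rpower (rho UR) (- ((alpha + 1) / 2)))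
  | Shock =>
      v U = v UR /\ rho U > rho UR /\
      u U = u UR + sqrt (A (v UR) * (1 / rho U - 1 / rho UR)
                         * (1 / Rpower (rho U) alpha
                            - 1 / Rpower (rho UR) alpha))
  end.

Definition contact (alpha : R) (A : R -> R) (M1 M2 : state) : Prop :=
  u M1 = u M2 /\
  rho M1 = Rpower (A (v M1) / A (v M2)) (1 / alpha) * rho M2.

Definition wave_combination (alpha : R) (A : R -> R) (X Y : wave_kind)
  (UL UR M1 M2 : state) : Prop :=
  0 < rho M1 /\ 0 < rho M2 /\
  wave1 alpha A X UL M1 /\ contact alpha A M1 M2 /\ wave3_inv alpha A Y UR M2.

Definition connected (alpha : R) (A : R -> R) (X Y : wave_kind)
  (UL UR : state) : Prop :=
  exists M1 M2 : state, wave_combination alpha A X Y UL UR M1 M2.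

(* The 1-wave and the 3-wave may be trivial here. A trivial contact
   discontinuity, M1 = M2, already satisfies [contact]. *)
Definition classical_solution (alpha : R) (A : R -> R)
  (UL UR M1 M2 : state) : Prop :=
  0 < rho M1 /\ 0 < rho M2 /\
  (M1 = UL \/ exists X : wave_kind, wave1 alpha A X UL M1) /\
  contact alpha A M1 M2 /\
  (M2 = UR \/ exists Y : wave_kind, wave3_inv alpha A Y UR M2).

Definition ratio (alpha : R) (A : R -> R) (UL UR : state) : R :=
  Rpower (A (v UR) / A (v UL)) (1 / alpha).

Definition region_RR (alpha : R) (A : R -> R) (UL UR : state) : Prop :=
  let AL := A (v UL) in
  let AR := A (v UR) in
  let r := ratio alpha A UL UR in
  let gamma := (alpha + 1) / 2 in
  let rho_min := Rmin (rho UR) (r * rho UL) in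
  u UR > u UL
         + 2 * sqrt (alpha * AR) / (alpha + 1)
           * (1 / Rpower rho_min gamma - 1 / Rpower (rho UR) gamma)
         + 2 * sqrt (alpha * AL) / (alpha + 1)
           * (1 / Rpower (rho_min / r) gamma - 1 / Rpower (rho UL) gamma).

Definition region_RS (alpha : R) (A : R -> R) (UL UR : state) : Prop :=
  let AL := A (v UL) in
  let AR := A (v UR) in
  let r := ratio alpha A UL UR in
  let gamma := (alpha + 1) / 2 in
  rho UR < r * rho UL /\
  u UL - sqrt (AR * (1 / (r * rho UL) - 1 / rho UR)
               * (1 / Rpower (r * rho UL) alpha - 1 / Rpower (rho UR) alpha))
  < u UR
  < u UL + 2 * sqrt (alpha * AL) / (alpha + 1)
           * (1 / Rpower (rho UR / r) gamma - 1 / Rpower (rho UL) gamma).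

Definition region_SR (alpha : R) (A : R -> R) (UL UR : state) : Prop :=
  let AL := A (v UL) in
  let AR := A (v UR) in
  let r := ratio alpha A UL UR in
  let gamma := (alpha + 1) / 2 in
  r * rho UL < rho UR /\
  u UL - sqrt (AL * (r / rho UR - 1 / rho UL)
               * (Rpower r alpha / Rpower (rho UR) alpha
                  - 1 / Rpower (rho UL) alpha))
  < u UR
  < u UL + 2 * sqrt (alpha * AR) / (alpha + 1)
           * (1 / Rpower (r * rho UL) gamma - 1 / Rpower (rho UR) gamma).

(* Limit case in which S_1(UL) and IS_3(UR) meet only at infinite density:
   each square root is the total velocity jump along one shock curve. *)
Definition u_crit (alpha : R) (A : R -> R) (UL UR : state) : R :=
  u UL - sqrt (A (v UR) / Rpower (rho UR) (alpha + 1))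
       - sqrt (A (v UL) / Rpower (rho UL) (alpha + 1)).

Definition region_SS (alpha : R) (A : R -> R) (UL UR : state) : Prop :=
  let AL := A (v UL) in
  let AR := A (v UR) in
  let r := ratio alpha A UL UR in
  let rho_max := Rmax (rho UR) (r * rho UL) in
  u UR > u_crit alpha A UL UR /\
  u UR < u UL
         - sqrt (AR * (1 / rho_max - 1 / rho UR)
                 * (1 / Rpower rho_max alpha - 1 / Rpower (rho UR) alpha))
         - sqrt (AL * (r / rho_max - 1 / rho UL)
                 * (Rpower r alpha / Rpower rho_max alpha
                    - 1 / Rpower (rho UL) alpha)).

Definition region (alpha : R) (A : R -> R) (X Y : wave_kind)
  (UL UR : state) : Prop :=
  match X, Y with
  | Rarefaction, Rarefaction => region_RR alpha A UL UR
  | Rarefaction, Shock => region_RS alpha A UL UR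
  | Shock, Rarefaction => region_SR alpha A UL UR
  | Shock, Shock => region_SS alpha A UL UR
  end.

(* Main.v *)
Require Import Defs.
From Stdlib Require Import Reals Lra Ranalysis5.
Open Scope R_scope.

(** The whole problem reduces to one scalar equation.  Glue the rarefaction
    and shock branches of each wave curve at the outer state: this gives the
    velocity jump ([jump]) as one function of the density [x] at the far end of
    the wave.  It is continuous and strictly decreasing on [x > 0], blows up as
    [x] tends to [0], and decreases to [- shock_limit] as [x] tends to infinity
    without reaching it.

    The contact discontinuity ties the two middle densities together, so one
    unknown [s], the density to its right, determines both middle states.  The
    jump in velocity across the 1-wave plus the one across the 3-wave is
    [total_jump s], and [(M1, M2)] solves the Riemann problem exactly when
    [total_jump s = u UR - u UL] ([wave_combination_iff],
    [classical_solution_iff]).  The 1-wave is a rarefaction or a shock according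
    to the side of [r * rho UL] on which [s] lies, where [r] is the [ratio] of
    the densities across the contact, and the 3-wave according to the side of
    [rho UR].

    Since [total_jump] decreases strictly and continuously onto all values above
    the one that corresponds to [u_crit] ([total_jump_decreasing],
    [total_jump_gt_crit], [total_jump_surjective]), the position of [s] relative
    to these two thresholds can be read off by comparing [u UR - u UL] with the
    values of [total_jump] there.  Written out, those comparisons are the four
    regions ([region_iff]).  Uniqueness and disjointness are the injectivity of
    [total_jump]; solvability, with trivial waves allowed, is its range. *)

(** * Powers of positive reals *)

Lemma Rpower_opp_decreasing (p x y : R) :
  0 < p -> 0 < x -> x < y -> Rpower y (- p) < Rpower x (- p).
Proof.
  intros hp hx hxy. rewrite !Rpower_Ropp.
  apply Rinv_lt_contravar.
  - apply Rmult_lt_0_compat; apply exp_pos.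
  - apply Rlt_Rpower_l; lra.
Qed.

Lemma Rpower_opp_nonincreasing (p x y : R) :
  0 < p -> 0 < x -> x <= y -> Rpower y (- p) <= Rpower x (- p).
Proof.
  intros hp hx [hxy | ->]; [| lra].
  left; apply Rpower_opp_decreasing; assumption.
Qed.

Lemma Rpower_opp_surjective (p c : R) :
  0 < p -> 0 < c -> exists x, 0 < x /\ Rpower x (- p) = c.
Proof.
  intros hp hc. exists (Rpower c (/ - p)). split; [apply exp_pos |].
  rewrite Rpower_mult, Rinv_l by lra. apply Rpower_1, hc.
Qed.

Lemma Rpower_opp_one (x : R) : 0 < x -> Rpower x (- (1)) = 1 / x.
Proof.
  intros hx. rewrite Rpower_Ropp, Rpower_1 by assumption. unfold Rdiv; ring.
Qed.

Lemma Rpower_opp_div (p x : R) : Rpower x (- p) = 1 / Rpower x p.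
Proof. rewrite Rpower_Ropp. unfold Rdiv; ring. Qed.

Lemma Rpower_div (p x y : R) :
  0 < x -> 0 < y -> Rpower (x / y) p = Rpower x p / Rpower y p.
Proof.
  intros hx hy.
  assert (Rpower (x / y) p * Rpower y p = Rpower x p) as <-.
  { rewrite Rpower_mult_distr; [| apply Rdiv_lt_0_compat; lra | lra].
    f_equal. field. lra. }
  field. apply Rgt_not_eq, exp_pos.
Qed.

Lemma Rpower_continuity_pt (p x : R) :
  0 < x -> continuity_pt (fun y => Rpower y p) x.
Proof.
  intros hx. apply derivable_continuous_pt.
  exists (p * Rpower x (p - 1)). apply derivable_pt_lim_power, hx.
Qed.

Lemma Rmin_continuity_pt (c x : R) : continuity_pt (fun y => Rmin y c) x.
Proof.
  apply (continuity_pt_locally_ext (fun y => (y + c - Rabs (y - c)) / 2) _ 1); [lra | |].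
  - intros y _. unfold Rmin, Rabs.
    destruct (Rle_dec y c), (Rcase_abs (y - c)); lra.
  - assert (continuity_pt (fun y => Rabs (y - c)) x).
    { apply (continuity_pt_comp (fun y => y - c) Rabs); [| apply Rcontinuity_abs].
      reg. }
    apply (continuity_pt_mult (fun y => y + c - Rabs (y - c)) (fun _ => / 2));
      [| reg].
    apply (continuity_pt_minus (fun y => y + c) (fun y => Rabs (y - c)));
      [reg | assumption].
Qed.

Lemma Rmax_continuity_pt (c x : R) : continuity_pt (fun y => Rmax y c) x.
Proof.
  apply (continuity_pt_locally_ext (fun y => y + c - Rmin y c) _ 1); [lra | |].
  - intros y _. unfold Rmin, Rmax. destruct (Rle_dec y c); lra.
  - apply (continuity_pt_minus (fun y => y + c) (fun y => Rmin y c));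
      [reg | apply Rmin_continuity_pt].
Qed.

(** * Velocity jump along the wave curve of one state *)

Definition rarefaction_jump (alpha a r0 x : R) : R :=
  2 * sqrt (alpha * a) / (alpha + 1)
  * (Rpower x (- ((alpha + 1) / 2)) - Rpower r0 (- ((alpha + 1) / 2))).

Definition shock_jump (alpha a r0 x : R) : R :=
  sqrt (a * (1 / x - 1 / r0) * (1 / Rpower x alpha - 1 / Rpower r0 alpha)).

(** The rarefaction branch ([x < r0]) and the shock branch ([r0 < x]) glued at
    [r0].  Each term vanishes on the other side of [r0], so that no case
    distinction is needed. *)
Definition jump (alpha a r0 x : R) : R :=
  rarefaction_jump alpha a r0 (Rmin x r0) - shock_jump alpha a r0 (Rmax x r0).

Definition shock_limit (alpha a r0 : R) : R :=
  sqrt (a / Rpower r0 (alpha + 1)).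

Lemma rarefaction_jump_self (alpha a r0 : R) : rarefaction_jump alpha a r0 r0 = 0.
Proof. unfold rarefaction_jump. ring. Qed.

Lemma shock_jump_self (alpha a r0 : R) : shock_jump alpha a r0 r0 = 0.
Proof.
  unfold shock_jump. rewrite <- sqrt_0. f_equal. ring.
Qed.

Lemma jump_rarefaction (alpha a r0 x : R) :
  x <= r0 -> jump alpha a r0 x = rarefaction_jump alpha a r0 x.
Proof.
  intros h. unfold jump.
  rewrite Rmin_left, Rmax_right, shock_jump_self by assumption. ring.
Qed.

Lemma jump_shock (alpha a r0 x : R) :
  r0 <= x -> jump alpha a r0 x = - shock_jump alpha a r0 x.
Proof.
  intros h. unfold jump.
  rewrite Rmin_right, Rmax_left, rarefaction_jump_self by assumption. ring.
Qed.

Lemma jump_self (alpha a r0 : R) : jump alpha a r0 r0 = 0.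
Proof. rewrite jump_rarefaction by lra. apply rarefaction_jump_self. Qed.

Lemma rarefaction_coefficient_pos (alpha a : R) :
  0 < alpha -> 0 < a -> 0 < 2 * sqrt (alpha * a) / (alpha + 1).
Proof.
  intros halpha ha. apply Rdiv_lt_0_compat; [| lra].
  apply Rmult_lt_0_compat; [lra |].
  apply sqrt_lt_R0, Rmult_lt_0_compat; assumption.
Qed.

Lemma rarefaction_jump_decreasing (alpha a r0 x y : R) :
  0 < alpha -> 0 < a -> 0 < x -> x < y ->
  rarefaction_jump alpha a r0 y < rarefaction_jump alpha a r0 x.
Proof.
  intros halpha ha hx hxy. unfold rarefaction_jump.
  apply Rmult_lt_compat_l; [apply rarefaction_coefficient_pos; assumption |].
  apply Rplus_lt_compat_r, Rpower_opp_decreasing; lra.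
Qed.

(** In [shock_jump] both differences are nonpositive for [x >= r0].  Reversing
    both makes them nonnegative and increasing in [x], which gives monotonicity
    and the limit factor by factor. *)
Lemma shock_jump_powers (alpha a r0 x : R) :
  0 < r0 -> 0 < x ->
  shock_jump alpha a r0 x
  = sqrt (a * (Rpower r0 (- (1)) - Rpower x (- (1)))
            * (Rpower r0 (- alpha) - Rpower x (- alpha))).
Proof.
  intros hr hx. unfold shock_jump. f_equal.
  rewrite !Rpower_opp_one, !Rpower_opp_div by assumption. ring.
Qed.

(** The limit of [shock_jump]: the powers of [x] are replaced by [0]. *)
Lemma shock_limit_powers (alpha a r0 : R) :
  0 < r0 ->
  shock_limit alpha a r0 = sqrt (a * Rpower r0 (- (1)) * Rpower r0 (- alpha)).
Proof.
  intros hr. unfold shock_limit. f_equal.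
  rewrite Rmult_assoc, <- Rpower_plus.
  replace (- (1) + - alpha) with (- (alpha + 1)) by ring.
  rewrite Rpower_Ropp. reflexivity.
Qed.

Lemma shock_jump_increasing (alpha a r0 x y : R) :
  0 < alpha -> 0 < a -> 0 < r0 -> r0 <= x -> x < y ->
  shock_jump alpha a r0 x < shock_jump alpha a r0 y.
Proof.
  intros halpha ha hr hrx hxy. rewrite !shock_jump_powers by lra.
  pose proof (Rpower_opp_nonincreasing 1 r0 x ltac:(lra) hr hrx).
  pose proof (Rpower_opp_nonincreasing alpha r0 x halpha hr hrx).
  pose proof (Rpower_opp_decreasing 1 x y ltac:(lra) ltac:(lra) hxy).
  pose proof (Rpower_opp_decreasing alpha x y halpha ltac:(lra) hxy).
  apply sqrt_lt_1_alt. split.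
  - apply Rmult_le_pos; [apply Rmult_le_pos |]; lra.
  - rewrite !Rmult_assoc. apply Rmult_lt_compat_l; [assumption |].
    apply Rmult_le_0_lt_compat; lra.
Qed.

Lemma shock_jump_lt_limit (alpha a r0 x : R) :
  0 < alpha -> 0 < a -> 0 < r0 -> r0 <= x ->
  shock_jump alpha a r0 x < shock_limit alpha a r0.
Proof.
  intros halpha ha hr hrx.
  rewrite shock_jump_powers, shock_limit_powers by lra.
  pose proof (Rpower_opp_nonincreasing 1 r0 x ltac:(lra) hr hrx).
  pose proof (Rpower_opp_nonincreasing alpha r0 x halpha hr hrx).
  assert (0 < Rpower x (- (1))) by apply exp_pos.
  assert (0 < Rpower x (- alpha)) by apply exp_pos.
  apply sqrt_lt_1_alt. split.
  - apply Rmult_le_pos; [apply Rmult_le_pos |]; lra.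
  - rewrite !Rmult_assoc. apply Rmult_lt_compat_l; [assumption |].
    apply Rmult_le_0_lt_compat; lra.
Qed.

Lemma shock_limit_pos (alpha a r0 : R) : 0 < a -> 0 < shock_limit alpha a r0.
Proof.
  intros ha. apply sqrt_lt_R0, Rdiv_lt_0_compat; [assumption | apply exp_pos].
Qed.

Lemma jump_decreasing (alpha a r0 x y : R) :
  0 < alpha -> 0 < a -> 0 < r0 -> 0 < x -> x < y ->
  jump alpha a r0 y < jump alpha a r0 x.
Proof.
  intros halpha ha hr hx hxy.
  destruct (Rle_or_lt r0 x) as [hrx | hxr].
  - rewrite !jump_shock by lra. apply Ropp_lt_contravar.
    apply shock_jump_increasing; assumption.
  - rewrite (jump_rarefaction _ _ _ x) by lra.
    destruct (Rle_or_lt y r0) as [hyr | hry].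
    + rewrite jump_rarefaction by assumption.
      apply rarefaction_jump_decreasing; assumption.
    + rewrite jump_shock by lra. apply Rle_lt_trans with 0.
      * assert (0 <= shock_jump alpha a r0 y) by apply sqrt_pos. lra.
      * rewrite <- (rarefaction_jump_self alpha a r0).
        apply rarefaction_jump_decreasing; assumption.
Qed.

Lemma jump_gt_limit (alpha a r0 x : R) :
  0 < alpha -> 0 < a -> 0 < r0 -> 0 < x ->
  - shock_limit alpha a r0 < jump alpha a r0 x.
Proof.
  intros halpha ha hr hx.
  destruct (Rle_or_lt r0 x) as [hrx | hxr].
  - rewrite jump_shock by assumption. apply Ropp_lt_contravar.
    apply shock_jump_lt_limit; assumption.
  - pose proof (jump_decreasing alpha a r0 x r0 halpha ha hr hx hxr).
    rewrite jump_self in *. pose proof (shock_limit_pos alpha a r0 ha). lra.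
Qed.

(** As [x] tends to [0] the negative power of [x] in the rarefaction branch is
    unbounded. *)
Lemma jump_unbounded (alpha a r0 M : R) :
  0 < alpha -> 0 < a -> 0 < r0 ->
  exists N, 0 < N /\ forall x, 0 < x -> x <= N -> M <= jump alpha a r0 x.
Proof.
  intros halpha ha hr.
  pose proof (rarefaction_coefficient_pos alpha a halpha ha) as hc.
  set (c := 2 * sqrt (alpha * a) / (alpha + 1)) in hc.
  set (q := Rpower r0 (- ((alpha + 1) / 2))).
  assert (0 < q) by apply exp_pos.
  assert (0 <= Rabs M / c) by (apply Rle_mult_inv_pos; [apply Rabs_pos | lra]).
  (* Rabs M instead of M keeps the prescribed value of the power positive. *)
  destruct (Rpower_opp_surjective ((alpha + 1) / 2) (Rabs M / c + q))
    as (N & hN & eN); [lra | lra |].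
  exists (Rmin N r0). split; [apply Rmin_pos; assumption |].
  intros x hx hxN.
  assert (x <= N) by (eapply Rle_trans; [exact hxN | apply Rmin_l]).
  assert (x <= r0) by (eapply Rle_trans; [exact hxN | apply Rmin_r]).
  rewrite jump_rarefaction by assumption. unfold rarefaction_jump.
  fold c q.
  pose proof (Rpower_opp_nonincreasing ((alpha + 1) / 2) x N
                ltac:(lra) hx ltac:(assumption)) as hp.
  rewrite eN in hp.
  apply Rle_trans with (Rabs M); [apply Rle_abs |].
  replace (Rabs M) with (c * (Rabs M / c)) by (field; lra).
  apply Rmult_le_compat_l; lra.
Qed.

(** As [x] tends to infinity the two powers of [x] in [shock_jump_powers] vanish,
    so that [- shock_limit] is the infimum of the jump. *)
Lemma jump_approaches_limit (alpha a r0 c : R) :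
  0 < alpha -> 0 < a -> 0 < r0 -> - shock_limit alpha a r0 < c ->
  exists N, 0 < N /\ forall x, N <= x -> jump alpha a r0 x <= c.
Proof.
  intros halpha ha hr hc.
  pose proof (shock_limit_pos alpha a r0 ha) as hL.
  set (L := shock_limit alpha a r0) in *.
  (* If both factors under the root are within a fraction e of their limits,
     the root is within the fraction e of L. *)
  set (e := Rmin 1 ((c + L) / L)).
  assert (he : 0 < e)
    by (apply Rmin_pos; [lra | apply Rdiv_lt_0_compat; lra]).
  assert (he1 : e <= 1) by apply Rmin_l.
  assert (heL : e * L <= c + L).
  { replace (c + L) with ((c + L) / L * L) by (field; lra).
    apply Rmult_le_compat_r; [lra | apply Rmin_r]. }
  set (P := Rpower r0 (- (1))). set (Q := Rpower r0 (- alpha)).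
  assert (hP : 0 < P) by apply exp_pos.
  assert (hQ : 0 < Q) by apply exp_pos.
  destruct (Rpower_opp_surjective 1 (e * P)) as (N1 & hN1 & e1);
    [lra | apply Rmult_lt_0_compat; assumption |].
  destruct (Rpower_opp_surjective alpha (e * Q)) as (N2 & hN2 & e2);
    [lra | apply Rmult_lt_0_compat; assumption |].
  exists (Rmax r0 (Rmax N1 N2)).
  split; [eapply Rlt_le_trans; [exact hr | apply Rmax_l] |].
  intros x hx.
  pose proof (Rmax_l r0 (Rmax N1 N2)). pose proof (Rmax_r r0 (Rmax N1 N2)).
  pose proof (Rmax_l N1 N2). pose proof (Rmax_r N1 N2).
  pose proof (Rpower_opp_nonincreasing 1 N1 x ltac:(lra) hN1 ltac:(lra)) as h1.
  pose proof (Rpower_opp_nonincreasing alpha N2 x halpha hN2 ltac:(lra)) as h2.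
  rewrite e1 in h1. rewrite e2 in h2.
  rewrite jump_shock, shock_jump_powers by lra. fold P Q.
  assert ((1 - e) * L
          <= sqrt (a * (P - Rpower x (- (1))) * (Q - Rpower x (- alpha)))).
  { unfold L. rewrite shock_limit_powers by assumption. fold P Q.
    rewrite <- (sqrt_pow2 (1 - e)) by lra.
    rewrite <- sqrt_mult_alt by apply pow2_ge_0.
    apply sqrt_le_1_alt.
    replace ((1 - e) ^ 2 * (a * P * Q))
      with (a * ((P - e * P) * (Q - e * Q))) by ring.
    rewrite Rmult_assoc. apply Rmult_le_compat_l; [lra |].
    assert (0 <= (1 - e) * P) by (apply Rmult_le_pos; lra).
    assert (0 <= (1 - e) * Q) by (apply Rmult_le_pos; lra).
    apply Rmult_le_compat; lra. }
  lra.
Qed.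

Lemma jump_continuity_pt (alpha a r0 x : R) :
  0 < a -> 0 < alpha -> 0 < r0 -> 0 < x -> continuity_pt (jump alpha a r0) x.
Proof.
  intros ha halpha hr hx.
  assert (hmin : 0 < Rmin x r0) by (apply Rmin_pos; assumption).
  assert (hmax : r0 <= Rmax x r0) by apply Rmax_r.
  apply (continuity_pt_minus
           (fun y => rarefaction_jump alpha a r0 (Rmin y r0))
           (fun y => shock_jump alpha a r0 (Rmax y r0))).
  - apply (continuity_pt_comp (fun y => Rmin y r0) (rarefaction_jump alpha a r0));
      [apply Rmin_continuity_pt |].
    apply continuity_pt_scal with (f := fun y => Rpower y (- ((alpha + 1) / 2))
                          - Rpower r0 (- ((alpha + 1) / 2))).
    apply (continuity_pt_minus (fun y => Rpower y (- ((alpha + 1) / 2)))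
             (fun _ => Rpower r0 (- ((alpha + 1) / 2))));
      [apply Rpower_continuity_pt; assumption | apply continuity_pt_const; now intros ? ?].
  - apply (continuity_pt_comp (fun y => Rmax y r0) (shock_jump alpha a r0));
      [apply Rmax_continuity_pt |].
    set (m := Rmax x r0) in *.
    assert (hm : 0 < m) by lra.
    pose proof (exp_pos (alpha * ln m)) as hpm. fold (Rpower m alpha) in hpm.
    apply (continuity_pt_comp
      (fun y => a * (1 / y - 1 / r0) * (1 / Rpower y alpha - 1 / Rpower r0 alpha))
      sqrt).
    + apply (continuity_pt_mult (fun y => a * (1 / y - 1 / r0))
               (fun y => 1 / Rpower y alpha - 1 / Rpower r0 alpha)).
      * reg. lra.
      * apply (continuity_pt_minus (fun y => 1 / Rpower y alpha)
                 (fun _ => 1 / Rpower r0 alpha)); [| apply continuity_pt_const; now intros ? ?].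
        apply (continuity_pt_div (fun _ => 1) (fun y => Rpower y alpha));
          [apply continuity_pt_const; now intros ? ? | apply Rpower_continuity_pt; lra | lra].
    + apply continuity_pt_sqrt.
      pose proof (Rpower_opp_nonincreasing 1 r0 m ltac:(lra) hr hmax).
      pose proof (Rpower_opp_nonincreasing alpha r0 m halpha hr hmax).
      rewrite !Rpower_opp_one, !Rpower_opp_div in * by lra.
      rewrite Rmult_assoc. apply Rmult_le_pos; [lra |].
      rewrite <- Rmult_opp_opp. apply Rmult_le_pos; lra.
Qed.

(** * Solutions as level points of the total velocity jump *)

Definition on_branch (X : wave_kind) (r0 x : R) : Prop :=
  match X with Rarefaction => x < r0 | Shock => r0 < x end.

(** Velocity gained from [UL] to [UR] when the density to the right of the
    contact discontinuity is [s]. *)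
Definition total_jump (alpha : R) (A : R -> R) (UL UR : state) (s : R) : R :=
  jump alpha (A (v UL)) (rho UL) (s / ratio alpha A UL UR)
  + jump alpha (A (v UR)) (rho UR) s.

Definition left_middle (alpha : R) (A : R -> R) (UL UR : state) (s : R) : state :=
  let x := s / ratio alpha A UL UR in
  mkState x (u UL + jump alpha (A (v UL)) (rho UL) x) (v UL).

Definition right_middle (alpha : R) (A : R -> R) (UR : state) (s : R) : state :=
  mkState s (u UR - jump alpha (A (v UR)) (rho UR) s) (v UR).

Lemma ratio_pos (alpha : R) (A : R -> R) (UL UR : state) :
  0 < ratio alpha A UL UR.
Proof. apply exp_pos. Qed.

Lemma on_branch_scale (X : wave_kind) (r r0 s : R) :
  0 < r -> (on_branch X r0 (s / r) <-> on_branch X (r * r0) s).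
Proof.
  intros hr. assert (e : s = r * (s / r)) by (field; lra).
  destruct X; simpl; split; intros h.
  - rewrite e. apply Rmult_lt_compat_l; assumption.
  - apply Rmult_lt_reg_l with r; [| rewrite <- e]; assumption.
  - rewrite e. apply Rmult_lt_compat_l; assumption.
  - apply Rmult_lt_reg_l with r; [| rewrite <- e]; assumption.
Qed.

Lemma on_branch_unique (X X' : wave_kind) (r0 x : R) :
  on_branch X r0 x -> on_branch X' r0 x -> X = X'.
Proof. destruct X, X'; simpl; intros; reflexivity || lra. Qed.

Lemma on_branch_total (r0 x : R) : x = r0 \/ exists X, on_branch X r0 x.
Proof.
  destruct (Rtotal_order x r0) as [h | [h | h]].
  - right; exists Rarefaction; exact h.
  - left; exact h.
  - right; exists Shock; exact h.
Qed.

Lemma wave1_iff (alpha : R) (A : R -> R) (X : wave_kind) (UL U : state) :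
  0 < rho U ->
  (wave1 alpha A X UL U <->
   on_branch X (rho UL) (rho U) /\ v U = v UL /\
   u U = u UL + jump alpha (A (v UL)) (rho UL) (rho U)).
Proof.
  intros hU. destruct X; simpl; split.
  - intros (hv & [_ hr] & hu). rewrite jump_rarefaction by lra. auto.
  - intros (hr & hv & hu). rewrite jump_rarefaction in hu by lra. auto.
  - intros (hv & hr & hu). rewrite jump_shock by lra. auto.
  - intros (hr & hv & hu). rewrite jump_shock in hu by lra. auto.
Qed.

Lemma wave3_inv_iff (alpha : R) (A : R -> R) (Y : wave_kind) (UR U : state) :
  0 < rho U ->
  (wave3_inv alpha A Y UR U <->
   on_branch Y (rho UR) (rho U) /\ v U = v UR /\
   u U = u UR - jump alpha (A (v UR)) (rho UR) (rho U)).
Proof.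
  intros hU. destruct Y; simpl; split.
  - intros (hv & [_ hr] & hu). rewrite jump_rarefaction by lra. auto.
  - intros (hr & hv & hu). rewrite jump_rarefaction in hu by lra. auto.
  - intros (hv & hr & hu). rewrite jump_shock by lra.
    unfold Rminus. rewrite Ropp_involutive. auto.
  - intros (hr & hv & hu). rewrite jump_shock in hu by lra.
    unfold Rminus in hu. rewrite Ropp_involutive in hu. auto.
Qed.

(** The glued curve passes through the outer state itself, so allowing a trivial
    wave amounts to dropping the condition on the branch. *)
Lemma trivial_or_wave1_iff (alpha : R) (A : R -> R) (UL U : state) :
  0 < rho U ->
  (U = UL \/ (exists X, wave1 alpha A X UL U) <->
   v U = v UL /\ u U = u UL + jump alpha (A (v UL)) (rho UL) (rho U)).
Proof.
  intros hU. split.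
  - intros [-> | [X hX]].
    + rewrite jump_self, Rplus_0_r. auto.
    + apply wave1_iff in hX; [apply hX | assumption].
  - intros [hv hu]. destruct (on_branch_total (rho UL) (rho U)) as [e | [X hX]].
    + left. rewrite e, jump_self, Rplus_0_r in hu.
      destruct U, UL; simpl in *; congruence.
    + right. exists X. apply wave1_iff; auto.
Qed.

Lemma trivial_or_wave3_inv_iff (alpha : R) (A : R -> R) (UR U : state) :
  0 < rho U ->
  (U = UR \/ (exists Y, wave3_inv alpha A Y UR U) <->
   v U = v UR /\ u U = u UR - jump alpha (A (v UR)) (rho UR) (rho U)).
Proof.
  intros hU. split.
  - intros [-> | [Y hY]].
    + rewrite jump_self, Rminus_0_r. auto.
    + apply wave3_inv_iff in hY; [apply hY | assumption].
  - intros [hv hu]. destruct (on_branch_total (rho UR) (rho U)) as [e | [Y hY]].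
    + left. rewrite e, jump_self, Rminus_0_r in hu.
      destruct U, UR; simpl in *; congruence.
    + right. exists Y. apply wave3_inv_iff; auto.
Qed.

(** [contact] scales densities by [A_L / A_R], the inverse of [ratio]. *)
Lemma contact_iff (alpha : R) (A : R -> R) (UL UR M1 M2 : state)
  (hApos : forall w, 0 < A w) :
  v M1 = v UL -> v M2 = v UR ->
  (contact alpha A M1 M2 <->
   u M1 = u M2 /\ rho M1 = rho M2 / ratio alpha A UL UR).
Proof.
  intros h1 h2. unfold contact. rewrite h1, h2.
  enough (Rpower (A (v UL) / A (v UR)) (1 / alpha) = / ratio alpha A UL UR) as ->.
  { unfold Rdiv. rewrite (Rmult_comm (/ _)). reflexivity. }
  unfold ratio. rewrite !Rpower_div by apply hApos.
  field. split; apply Rgt_not_eq, exp_pos.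
Qed.

(** Equality of the two middle velocities is the equation for [total_jump];
    everything else in the wave and contact conditions determines the middle
    states from [rho M2]. *)
Lemma middle_states_iff (alpha : R) (A : R -> R) (UL UR M1 M2 : state)
  (hApos : forall w, 0 < A w) :
  (v M1 = v UL /\ u M1 = u UL + jump alpha (A (v UL)) (rho UL) (rho M1)) /\
  contact alpha A M1 M2 /\
  (v M2 = v UR /\ u M2 = u UR - jump alpha (A (v UR)) (rho UR) (rho M2)) <->
  u UR - u UL = total_jump alpha A UL UR (rho M2) /\
  M1 = left_middle alpha A UL UR (rho M2) /\
  M2 = right_middle alpha A UR (rho M2).
Proof.
  unfold total_jump. split.
  - intros ((v1 & u1) & hc & v2 & u2).
    apply (contact_iff _ _ UL UR) in hc; [| assumption ..].
    destruct hc as [hu hrho]. unfold left_middle, right_middle.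
    rewrite hrho in u1. split; [lra |].
    destruct M1, M2; simpl in *; split; congruence.
  - intros (h & e1 & e2).
    assert (v1 : v M1 = v UL) by (rewrite e1; reflexivity).
    assert (v2 : v M2 = v UR) by (rewrite e2; reflexivity).
    assert (r1 : rho M1 = rho M2 / ratio alpha A UL UR)
      by (rewrite e1; reflexivity).
    assert (u1 : u M1 = u UL + jump alpha (A (v UL)) (rho UL) (rho M1))
      by (rewrite r1, e1; reflexivity).
    assert (u2 : u M2 = u UR - jump alpha (A (v UR)) (rho UR) (rho M2))
      by (rewrite e2 at 1; reflexivity).
    repeat match goal with |- (_ /\ _) => split end; try assumption.
    apply (contact_iff alpha A UL UR); try assumption.
    rewrite r1 in u1. split; [lra | assumption].
Qed.

Lemma wave_combination_iff (alpha : R) (A : R -> R) (X Y : wave_kind)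
  (UL UR M1 M2 : state) (hApos : forall w, 0 < A w) :
  wave_combination alpha A X Y UL UR M1 M2 <->
  exists s, 0 < s /\
    on_branch X (ratio alpha A UL UR * rho UL) s /\ on_branch Y (rho UR) s /\
    u UR - u UL = total_jump alpha A UL UR s /\
    M1 = left_middle alpha A UL UR s /\ M2 = right_middle alpha A UR s.
Proof.
  pose proof (ratio_pos alpha A UL UR) as hr. split.
  - intros (h1 & h2 & w1 & hc & w3).
    apply wave1_iff in w1; [| assumption].
    apply wave3_inv_iff in w3; [| assumption].
    destruct w1 as (b1 & w1), w3 as (b3 & w3).
    destruct (proj1 (middle_states_iff alpha A UL UR M1 M2 hApos))
      as (hs & e1 & e2); [auto |].
    exists (rho M2). repeat split; try assumption.
    apply on_branch_scale; [assumption |]. rewrite e1 in b1. exact b1.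
  - intros (s & h & b1 & b3 & hs & e1 & e2).
    assert (r2 : rho M2 = s) by (rewrite e2; reflexivity).
    assert (r1 : rho M1 = s / ratio alpha A UL UR) by (rewrite e1; reflexivity).
    assert (p1 : 0 < rho M1) by (rewrite r1; apply Rdiv_lt_0_compat; assumption).
    rewrite <- r2 in h, b1, b3, hs, e1, e2.
    destruct (proj2 (middle_states_iff alpha A UL UR M1 M2 hApos))
      as (w1 & hc & w3); [auto |].
    apply on_branch_scale in b1; [| assumption].
    rewrite r2, <- r1 in b1.
    repeat split; try assumption; try apply hc.
    + apply wave1_iff; auto.
    + apply wave3_inv_iff; auto.
Qed.

Lemma classical_solution_iff (alpha : R) (A : R -> R) (UL UR M1 M2 : state)
  (hApos : forall w, 0 < A w) :
  classical_solution alpha A UL UR M1 M2 <->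
  exists s, 0 < s /\ u UR - u UL = total_jump alpha A UL UR s /\
    M1 = left_middle alpha A UL UR s /\ M2 = right_middle alpha A UR s.
Proof.
  pose proof (ratio_pos alpha A UL UR) as hr. split.
  - intros (h1 & h2 & w1 & hc & w3).
    apply trivial_or_wave1_iff in w1; [| assumption].
    apply trivial_or_wave3_inv_iff in w3; [| assumption].
    exists (rho M2). split; [assumption |].
    apply (middle_states_iff alpha A UL UR M1 M2 hApos). auto.
  - intros (s & h & hs & e1 & e2).
    assert (r2 : rho M2 = s) by (rewrite e2; reflexivity).
    assert (r1 : rho M1 = s / ratio alpha A UL UR) by (rewrite e1; reflexivity).
    assert (p1 : 0 < rho M1) by (rewrite r1; apply Rdiv_lt_0_compat; assumption).
    rewrite <- r2 in h, hs, e1, e2.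
    destruct (proj2 (middle_states_iff alpha A UL UR M1 M2 hApos))
      as (w1 & hc & w3); [auto |].
    repeat split; try assumption; try apply hc.
    + apply trivial_or_wave1_iff; auto.
    + apply trivial_or_wave3_inv_iff; auto.
Qed.

(** * Range of the total velocity jump *)

Lemma total_jump_decreasing (alpha : R) (A : R -> R) (UL UR : state) (x y : R)
  (halpha : 0 < alpha) (hApos : forall w, 0 < A w)
  (hrhoL : 0 < rho UL) (hrhoR : 0 < rho UR) :
  0 < x -> x < y ->
  total_jump alpha A UL UR y < total_jump alpha A UL UR x.
Proof.
  intros hx hxy. pose proof (ratio_pos alpha A UL UR) as hr.
  apply Rplus_lt_compat; apply jump_decreasing; auto.
  - apply Rdiv_lt_0_compat; assumption.
  - apply Rmult_lt_compat_r; [apply Rinv_0_lt_compat |]; assumption.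
Qed.

Lemma total_jump_lt_iff (alpha : R) (A : R -> R) (UL UR : state) (x y : R)
  (halpha : 0 < alpha) (hApos : forall w, 0 < A w)
  (hrhoL : 0 < rho UL) (hrhoR : 0 < rho UR) :
  0 < x -> 0 < y ->
  (total_jump alpha A UL UR y < total_jump alpha A UL UR x <-> x < y).
Proof.
  intros hx hy. split; [| apply total_jump_decreasing; assumption].
  intros h. destruct (Rtotal_order x y) as [hxy | [-> | hxy]]; [assumption | lra |].
  apply (total_jump_decreasing alpha A UL UR) in hxy; auto. lra.
Qed.

Lemma total_jump_injective (alpha : R) (A : R -> R) (UL UR : state) (x y : R)
  (halpha : 0 < alpha) (hApos : forall w, 0 < A w)
  (hrhoL : 0 < rho UL) (hrhoR : 0 < rho UR) :
  0 < x -> 0 < y ->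
  total_jump alpha A UL UR x = total_jump alpha A UL UR y -> x = y.
Proof.
  intros hx hy h. destruct (Rtotal_order x y) as [hxy | [hxy | hxy]];
    [| assumption |];
    apply (total_jump_decreasing alpha A UL UR) in hxy; auto; lra.
Qed.

Lemma total_jump_gt_crit (alpha : R) (A : R -> R) (UL UR : state) (s : R)
  (halpha : 0 < alpha) (hApos : forall w, 0 < A w)
  (hrhoL : 0 < rho UL) (hrhoR : 0 < rho UR) :
  0 < s -> u_crit alpha A UL UR < u UL + total_jump alpha A UL UR s.
Proof.
  intros hs.
  pose proof (jump_gt_limit alpha (A (v UL)) (rho UL) (s / ratio alpha A UL UR)
                halpha (hApos _) hrhoL
                (Rdiv_lt_0_compat _ _ hs (ratio_pos alpha A UL UR))).
  pose proof (jump_gt_limit alpha (A (v UR)) (rho UR) s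
                halpha (hApos _) hrhoR hs).
  unfold u_crit, total_jump, shock_limit in *. lra.
Qed.

(** Intermediate value theorem between a density small enough for the
    rarefaction branches and one large enough for the shock branches. *)
Lemma total_jump_surjective (alpha : R) (A : R -> R) (UL UR : state)
  (halpha : 0 < alpha) (hApos : forall w, 0 < A w)
  (hrhoL : 0 < rho UL) (hrhoR : 0 < rho UR) :
  u_crit alpha A UL UR < u UR ->
  exists s, 0 < s /\ u UR - u UL = total_jump alpha A UL UR s.
Proof.
  intros hcrit. set (d := u UR - u UL).
  pose proof (ratio_pos alpha A UL UR) as hr. set (r := ratio alpha A UL UR) in *.
  pose proof (hApos (v UL)) as hL. pose proof (hApos (v UR)) as hR.
  set (lL := shock_limit alpha (A (v UL)) (rho UL)).
  set (lR := shock_limit alpha (A (v UR)) (rho UR)).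
  assert (hd : 0 < d + lL + lR)
    by (unfold u_crit in hcrit; fold (shock_limit alpha (A (v UL)) (rho UL)) in hcrit;
        fold (shock_limit alpha (A (v UR)) (rho UR)) in hcrit;
        unfold d, lL, lR; lra).
  (* Each jump may exceed its infimum by one third of the excess of d; the
     remaining third makes the inequality strict. *)
  set (e := (d + lL + lR) / 3).
  assert (he : 0 < e) by (unfold e; lra).
  destruct (jump_unbounded alpha (A (v UL)) (rho UL) (d + 1)) as (a1 & ha1 & k1); auto.
  destruct (jump_unbounded alpha (A (v UR)) (rho UR) 0) as (a2 & ha2 & k2); auto.
  destruct (jump_approaches_limit alpha (A (v UL)) (rho UL) (- lL + e))
    as (b1 & hb1 & m1); auto; [fold lL; lra |].
  destruct (jump_approaches_limit alpha (A (v UR)) (rho UR) (- lR + e))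
    as (b2 & hb2 & m2); auto; [fold lR; lra |].
  set (x := Rmin (r * a1) a2). set (y := Rmax (r * b1) b2).
  assert (hx : 0 < x) by (apply Rmin_pos; [apply Rmult_lt_0_compat |]; assumption).
  assert (hy : 0 < y)
    by (apply Rlt_le_trans with b2; [assumption | apply Rmax_r]).
  assert (gx : d < total_jump alpha A UL UR x).
  { assert (x / r <= a1).
    { apply Rmult_le_reg_r with r; [assumption |].
      replace (x / r * r) with x by (field; lra).
      rewrite (Rmult_comm a1). apply Rmin_l. }
    assert (0 < x / r) by (apply Rdiv_lt_0_compat; assumption).
    pose proof (k1 (x / r) ltac:(assumption) ltac:(assumption)).
    pose proof (k2 x hx (Rmin_r _ _)).
    unfold total_jump. fold r. lra. }
  assert (gy : total_jump alpha A UL UR y < d).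
  { assert (b1 <= y / r).
    { apply Rmult_le_reg_r with r; [assumption |].
      replace (y / r * r) with y by (field; lra).
      rewrite (Rmult_comm b1). apply Rmax_l. }
    pose proof (m1 (y / r) ltac:(assumption)).
    pose proof (m2 y (Rmax_r _ _)).
    unfold total_jump. fold r. unfold e in *. lra. }
  assert (hxy : x < y).
  { apply (total_jump_lt_iff alpha A UL UR); auto. lra. }
  destruct (IVT_interv (fun s => d - total_jump alpha A UL UR s) x y)
    as (s & hs & es); [| assumption | lra | lra |].
  - intros s hs.
    apply (continuity_pt_minus (fun _ => d) (total_jump alpha A UL UR));
      [apply continuity_pt_const; now intros ? ? |].
    apply (continuity_pt_plus
             (fun s => jump alpha (A (v UL)) (rho UL) (s / r))
             (jump alpha (A (v UR)) (rho UR)));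
      [| apply jump_continuity_pt; auto; lra].
    apply (continuity_pt_comp (fun s => s / r) (jump alpha (A (v UL)) (rho UL))).
    + reg.
    + apply jump_continuity_pt; auto. apply Rdiv_lt_0_compat; lra.
  - exists s. split; lra.
Qed.

(** * The regions as intervals of the total velocity jump *)

(** Each region compares [u UR - u UL] with values of [total_jump] at the
    thresholds [r * rho UL] and [rho UR].  At a threshold one of the two jumps is
    trivial and the other lies on a known branch, which is why the bounds of the
    mixed regions have a single term.  At the minimum of the thresholds both
    jumps are on the rarefaction branch, at the maximum both are on the shock
    branch.  Monotonicity turns the comparisons into inequalities for [s]. *)
Lemma region_iff (alpha : R) (A : R -> R) (X Y : wave_kind) (UL UR : state)
  (halpha : 0 < alpha) (hApos : forall w, 0 < A w)
  (hrhoL : 0 < rho UL) (hrhoR : 0 < rho UR) :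
  region alpha A X Y UL UR <->
  exists s, 0 < s /\
    on_branch X (ratio alpha A UL UR * rho UL) s /\ on_branch Y (rho UR) s /\
    u UR - u UL = total_jump alpha A UL UR s.
Proof.
  pose proof (ratio_pos alpha A UL UR) as hr.
  set (r := ratio alpha A UL UR) in *.
  assert (hrL : 0 < r * rho UL) by (apply Rmult_lt_0_compat; assumption).
  assert (hdiv : rho UL = r * rho UL / r) by (field; lra).
  assert (hscale : forall x y, x <= y -> x / r <= y / r).
  { intros x y hxy. apply Rmult_le_compat_r; [| assumption].
    left; apply Rinv_0_lt_compat, hr. }
  pose proof (fun x y => total_jump_lt_iff alpha A UL UR x y
                           halpha hApos hrhoL hrhoR) as hlt.
  pose proof (fun s => total_jump_gt_crit alpha A UL UR s
                           halpha hApos hrhoL hrhoR) as hcrit.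
  pose proof (total_jump_surjective alpha A UL UR halpha hApos hrhoL hrhoR) as hsurj.
  destruct X, Y; simpl.
  - set (m := Rmin (rho UR) (r * rho UL)).
    assert (hm : 0 < m) by (apply Rmin_pos; assumption).
    assert (hmR : m <= rho UR) by apply Rmin_l.
    assert (hmL : m <= r * rho UL) by apply Rmin_r.
    assert (hmL' : m / r <= rho UL) by (rewrite hdiv; apply hscale, hmL).
    assert (hreg : region_RR alpha A UL UR <->
                   total_jump alpha A UL UR m < u UR - u UL).
    { unfold region_RR, total_jump. cbv zeta. fold r m.
      rewrite !jump_rarefaction by assumption.
      unfold rarefaction_jump. rewrite !Rpower_opp_div. split; lra. }
    rewrite hreg. split.
    + intros h. destruct hsurj as (s & hs & es).
      { pose proof (hcrit m hm). lra. }
      rewrite es in h. apply (hlt s m hs hm) in h.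
      exists s. repeat split; lra.
    + intros (s & hs & b1 & b2 & ->). apply hlt; try assumption.
      apply Rmin_glb_lt; assumption.
  - assert (hreg : region_RS alpha A UL UR <->
       rho UR < r * rho UL /\
       total_jump alpha A UL UR (r * rho UL) < u UR - u UL
         < total_jump alpha A UL UR (rho UR)).
    { unfold region_RS. cbv zeta. fold r.
      enough (rho UR < r * rho UL ->
        total_jump alpha A UL UR (r * rho UL)
        = - shock_jump alpha (A (v UR)) (rho UR) (r * rho UL) /\
        total_jump alpha A UL UR (rho UR)
        = rarefaction_jump alpha (A (v UL)) (rho UL) (rho UR / r)) as hval.
      { unfold shock_jump, rarefaction_jump in hval.
        rewrite !Rpower_opp_div in hval.
        split; intros [h h']; destruct (hval h) as [e1 e2];
          (split; [exact h |]); rewrite e1, e2 in *; lra. }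
      intros h. unfold total_jump. fold r. rewrite <- hdiv, !jump_self.
      assert (rho UR / r <= rho UL) by (rewrite hdiv; apply hscale; lra).
      rewrite jump_shock, jump_rarefaction by lra.
      split; ring. }
    rewrite hreg. split.
    + intros (h & h1 & h2). destruct hsurj as (s & hs & es).
      { pose proof (hcrit _ hrL). lra. }
      rewrite es in h1, h2. apply (hlt s _ hs hrL) in h1.
      apply (hlt _ s hrhoR hs) in h2.
      exists s. auto.
    + intros (s & hs & b1 & b2 & ->).
      split; [lra |]. split; apply hlt; assumption.
  - assert (hreg : region_SR alpha A UL UR <->
       r * rho UL < rho UR /\
       total_jump alpha A UL UR (rho UR) < u UR - u UL
         < total_jump alpha A UL UR (r * rho UL)).
    { unfold region_SR. cbv zeta. fold r.
      enough (r * rho UL < rho UR ->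
        total_jump alpha A UL UR (rho UR)
        = - shock_jump alpha (A (v UL)) (rho UL) (rho UR / r) /\
        total_jump alpha A UL UR (r * rho UL)
        = rarefaction_jump alpha (A (v UR)) (rho UR) (r * rho UL)) as hval.
      { unfold shock_jump, rarefaction_jump in hval.
        rewrite !Rpower_opp_div in hval.
        replace (1 / (rho UR / r)) with (r / rho UR) in hval by (field; lra).
        replace (1 / Rpower (rho UR / r) alpha)
          with (Rpower r alpha / Rpower (rho UR) alpha) in hval
          by (rewrite Rpower_div by assumption; field; split;
              apply Rgt_not_eq, exp_pos).
        split; intros [h h']; destruct (hval h) as [e1 e2];
          (split; [exact h |]); rewrite e1, e2 in *; lra. }
      intros h. unfold total_jump. fold r. rewrite <- hdiv, !jump_self.
      assert (rho UL <= rho UR / r) by (rewrite hdiv; apply hscale; lra).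
      rewrite jump_shock, jump_rarefaction by lra.
      split; ring. }
    rewrite hreg. split.
    + intros (h & h1 & h2). destruct hsurj as (s & hs & es).
      { pose proof (hcrit _ hrhoR). lra. }
      rewrite es in h1, h2. apply (hlt s _ hs hrhoR) in h1.
      apply (hlt _ s hrL hs) in h2.
      exists s. auto.
    + intros (s & hs & b1 & b2 & ->).
      split; [lra |]. split; apply hlt; assumption.
  - set (m := Rmax (rho UR) (r * rho UL)).
    assert (hmR : rho UR <= m) by apply Rmax_l.
    assert (hmL : r * rho UL <= m) by apply Rmax_r.
    assert (hmL' : rho UL <= m / r) by (rewrite hdiv; apply hscale, hmL).
    assert (hm : 0 < m) by lra.
    assert (hreg : region_SS alpha A UL UR <->
                   u_crit alpha A UL UR < u UR /\
                   u UR - u UL < total_jump alpha A UL UR m).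
    { unfold region_SS, total_jump. cbv zeta. fold r m.
      rewrite !jump_shock by assumption.
      unfold shock_jump.
      replace (1 / (m / r)) with (r / m) by (field; lra).
      replace (1 / Rpower (m / r) alpha) with (Rpower r alpha / Rpower m alpha)
        by (rewrite Rpower_div by assumption; field; split;
            apply Rgt_not_eq, exp_pos).
      split; intros [h h']; split; lra. }
    rewrite hreg. split.
    + intros [h h']. destruct (hsurj h) as (s & hs & es).
      rewrite es in h'. apply (hlt m s hm hs) in h'.
      exists s. repeat split; lra.
    + intros (s & hs & b1 & b2 & e). split.
      * pose proof (hcrit s hs). lra.
      * rewrite e. apply hlt; try assumption. apply Rmax_lub_lt; assumption.
Qed.

Lemma connected_iff_region (alpha : R) (A : R -> R) (X Y : wave_kind)
  (UL UR : state) (halpha : 0 < alpha) (hApos : forall w, 0 < A w)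
  (hrhoL : 0 < rho UL) (hrhoR : 0 < rho UR) :
  connected alpha A X Y UL UR <-> region alpha A X Y UL UR.
Proof.
  rewrite region_iff by assumption. split.
  - intros (M1 & M2 & h). apply wave_combination_iff in h; [| assumption].
    destruct h as (s & hs & b1 & b2 & e & _). eauto.
  - intros (s & hs & b1 & b2 & e).
    exists (left_middle alpha A UL UR s), (right_middle alpha A UR s).
    apply wave_combination_iff; [assumption |]. exists s. repeat split; assumption.
Qed.

(** The density [s] is the same by injectivity of [total_jump]; it determines
    the middle states, and its position relative to the thresholds determines
    the kinds of wave. *)
Lemma wave_combination_unique (alpha : R) (A : R -> R)
  (X Y X' Y' : wave_kind) (UL UR M1 M2 M1' M2' : state)
  (halpha : 0 < alpha) (hApos : forall w, 0 < A w)
  (hrhoL : 0 < rho UL) (hrhoR : 0 < rho UR) :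
  wave_combination alpha A X Y UL UR M1 M2 ->
  wave_combination alpha A X' Y' UL UR M1' M2' ->
  X = X' /\ Y = Y' /\ M1 = M1' /\ M2 = M2'.
Proof.
  rewrite !wave_combination_iff by assumption.
  intros (s & hs & b1 & b2 & e & -> & ->) (s' & hs' & b1' & b2' & e' & -> & ->).
  assert (s = s') as <-.
  { apply (total_jump_injective alpha A UL UR); auto. congruence. }
  repeat split.
  - exact (on_branch_unique _ _ _ _ b1 b1').
  - exact (on_branch_unique _ _ _ _ b2 b2').
Qed.

(** * Solution of the Riemann problem *)

Theorem mainTheorem3 (alpha : R) (A : R -> R) (UL UR : state)
  (halpha0 : 0 < alpha) (halpha1 : alpha < 1)
  (hApos : forall w : R, 0 < A w) (hAcont : continuity A)
  (hrhoL : 0 < rho UL) (hrhoR : 0 < rho UR) :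
  (connected alpha A Rarefaction Rarefaction UL UR
     <-> region_RR alpha A UL UR) /\
  (connected alpha A Rarefaction Shock UL UR
     <-> region_RS alpha A UL UR) /\
  (connected alpha A Shock Rarefaction UL UR
     <-> region_SR alpha A UL UR) /\
  (connected alpha A Shock Shock UL UR
     <-> region_SS alpha A UL UR) /\
  (forall X Y : wave_kind, connected alpha A X Y UL UR ->
     exists! M : state * state,
       wave_combination alpha A X Y UL UR (fst M) (snd M)) /\
  (forall X Y X' Y' : wave_kind, (X, Y) <> (X', Y') ->
     ~ (region alpha A X Y UL UR /\ region alpha A X' Y' UL UR)) /\
  (forall (X Y X' Y' : wave_kind) (M1 M2 M1' M2' : state),
     wave_combination alpha A X Y UL UR M1 M2 ->
     wave_combination alpha A X' Y' UL UR M1' M2' ->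
     X = X' /\ Y = Y' /\ M1 = M1' /\ M2 = M2') /\
  (u UR > u_crit alpha A UL UR ->
     exists M1 M2 : state, classical_solution alpha A UL UR M1 M2) /\
  (u UR < u_crit alpha A UL UR ->
     ~ exists M1 M2 : state, classical_solution alpha A UL UR M1 M2).
Proof.
  pose proof (fun X Y => connected_iff_region alpha A X Y UL UR
                           halpha0 hApos hrhoL hrhoR) as hregion.
  repeat match goal with |- _ /\ _ => split end.
  - exact (hregion Rarefaction Rarefaction).
  - exact (hregion Rarefaction Shock).
  - exact (hregion Shock Rarefaction).
  - exact (hregion Shock Shock).
  - intros X Y (M1 & M2 & h). exists (M1, M2). split; [exact h |].
    intros [M1' M2'] h'.
    destruct (wave_combination_unique alpha A X Y X Y UL UR M1 M2 M1' M2')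
      as (_ & _ & -> & ->); auto.
  - intros X Y X' Y' hne [h h']. apply hregion in h, h'.
    destruct h as (M1 & M2 & h), h' as (M1' & M2' & h').
    destruct (wave_combination_unique alpha A X Y X' Y' UL UR M1 M2 M1' M2')
      as (-> & -> & _); auto.
  - intros. apply (wave_combination_unique alpha A X Y X' Y' UL UR); assumption.
  - intros h.
    destruct (total_jump_surjective alpha A UL UR halpha0 hApos hrhoL hrhoR h)
      as (s & hs & e).
    exists (left_middle alpha A UL UR s), (right_middle alpha A UR s).
    apply classical_solution_iff; [assumption |]. exists s. auto.
  - intros h (M1 & M2 & hsol). apply classical_solution_iff in hsol; [| assumption].
    destruct hsol as (s & hs & e & _).
    pose proof (total_jump_gt_crit alpha A UL UR s halpha0 hApos hrhoL hrhoR hs).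
    lra.
Qed.
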